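(* Let $\mathcal L$ be a homologically self-dual 2-category and let $\pi\colon\Pi\to\Pi'$ be a morphism of pure configurations in $\mathcal L$, with comparisons $j_\Pi\colon\mathrm{Cok}(f)\to\mathrm{Ker}(h)$ and $j_{\Pi'}\colon\mathrm{Cok}(f')\to\mathrm{Ker}(h')$ and induced 1-cells $\underline\pi_f\colon\mathrm{Cok}(f)\to\mathrm{Cok}(f')$ and $\bar\pi_h\colon\mathrm{Ker}(h)\to\mathrm{Ker}(h')$. Then there is a unique invertible 2-cell $$\nu_\pi\colon j_{\Pi'}\circ\underline\pi_f\cong\bar\pi_h\circ j_\Pi$$ compatible with the characterising 2-cells of $j_\Pi$ and $j_{\Pi'}$, in the following sense. Let $\alpha$ be the composite invertible 2-cell $$\ker(h')\circ j_{\Pi'}\circ\underline\pi_f\circ\operatorname{coker}(f)\cong\ker(h')\circ j_{\Pi'}\circ\operatorname{coker}(f')\circ\pi_X\cong b'\circ c'\circ\pi_X\cong b'\circ\pi_Y\circ c\cong\pi_C\circ b\circ c$$ built from, in turn, the defining 2-cell of $\underline\pi_f$, the characterising 2-cell of $j_{\Pi'}$, the inverse of $\pi_c$ and the inverse of $\pi_b$; and let $\beta$ be the composite invertible 2-cell $$\ker(h')\circ\bar\pi_h\circ j_\Pi\circ\operatorname{coker}(f)\cong\pi_C\circ\ker(h)\circ j_\Pi\circ\operatorname{coker}(f)\cong\pi_C\circ b\circ c$$ built from the defining 2-cell of $\bar\pi_h$ and the characterising 2-cell of $j_\Pi$. Then the whiskering $\ker(h')\star\nu_\pi\star\operatorname{coker}(f)$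 followed by $\beta$ equals $\alpha$.
   Context: 2-categories are strict. For 1-cells, $\cong$ denotes an invertible 2-cell. Whiskering is denoted $\star$. A bizero object of a 2-category $\mathcal L$ is an object $0$ such that for every object $A$ the hom-categories $\mathcal L(A,0)$ and $\mathcal L(0,A)$ are equivalent to the terminal category. A 1-cell is null if it factors through $0$; $f\cong 0$ means that $f$ is isomorphic to a null 1-cell. The bizero object is strong if between any two parallel 1-cells that factor through $0$ there is exactly one 2-cell. In a 2-category with a strong bizero object, a 2-kernel of $f\colon A\to B$ is a 1-cell $k\colon K\to A$ with an invertible 2-cell $f\circ k\cong 0$ such that (1) for every $z\colon Z\to A$ with $f\circ z\cong0$ there is $u\colon Z\to K$ with $k\circ u\cong z$; (2) for all $u,v\colon Z\to K$ and every 2-cell $\lambda\colon k\circ u\Rightarrow k\circ v$ there is a unique 2-cell $\mu\colon u\Rightarrow v$ with $k\star\mu=\lambda$. 2-cokernels are defined dually. They are unique up to equivalence and are written $\ker(f)\colon\mathrm{Ker}(f)\to A$ and $\operatorname{coker}(f)\colon B\to\mathrm{Cok}(f)$. A 2-z-exact 2-category is one with a strong bizero object and all 2-kernels and 2-cokernels. A normal 2-monomorphism (resp. normal 2-epimorphism) is a 1-cell that is a 2-kernel (resp. 2-cokernel) of some 1-cell; a 1-cell is normal if it is isomorphic to a normal 2-epimorphism followed by a normal 2-monomorphism. A 2-z-exact 2-category is homologically self-dual if for every normal 2-monomorphism $m\colon K\to X$ and normal 2-epimorphism $e\colon X\to R$ with $e\circ m\cong0$, the 1-cell $\operatorname{coker}(m)\circ\ker(e)$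 is normal. A short 2-exact sequence is a composable pair $(k,q)$ with $k$ a 2-kernel of $q$ and $q$ a 2-cokernel of $k$. A pure configuration $\Pi$ consists of two short 2-exact sequences $A\xrightarrow{a}Y\xrightarrow{b}C$ (top row) and $X\xrightarrow{c}Y\xrightarrow{d}Z$ (bottom row) through a common object $Y$, 1-cells $f\colon A\to X$ and $h\colon C\to Z$, and invertible 2-cells $\theta_f\colon a\cong c\circ f$ and $\theta_h\colon h\circ b\cong d$. In a homologically self-dual 2-category it has a comparison $j_\Pi\colon\mathrm{Cok}(f)\to\mathrm{Ker}(h)$ equipped with a characterising invertible 2-cell $\ker(h)\circ j_\Pi\circ\operatorname{coker}(f)\cong b\circ c$; it is an equivalence, and is unique up to a unique invertible 2-cell compatible with the characterising 2-cells. A morphism of pure configurations $\pi\colon\Pi\to\Pi'$ (data of $\Pi'$ are primed) consists of 1-cells $\pi_A\colon A\to A'$, $\pi_Y\colon Y\to Y'$, $\pi_C\colon C\to C'$, $\pi_X\colon X\to X'$, $\pi_Z\colon Z\to Z'$ and invertible 2-cells $\pi_a\colon\pi_Y\circ a\cong a'\circ\pi_A$, $\pi_b\colon\pi_C\circ b\cong b'\circ\pi_Y$, $\pi_c\colon\pi_Y\circ c\cong c'\circ\pi_X$, $\pi_d\colon\pi_Z\circ d\cong d'\circ\pi_Y$ (no further condition). Such a $\pi$ induces a unique invertible 2-cell $\pi_f\colon\pi_X\circ f\cong f'\circ\pi_A$ such that $c'\star\pi_f$ is the composite $c'\pi_Xf\cong\pi_Ycf\cong\pi_Ya\cong a'\pi_A\cong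 c'f'\pi_A$ built from $\pi_c^{-1},\theta_f^{-1},\pi_a,\theta'_f$; and a unique invertible 2-cell $\pi_h\colon\pi_Z\circ h\cong h'\circ\pi_C$ such that $\pi_h\star b$ is the composite $\pi_Zhb\cong\pi_Zd\cong d'\pi_Y\cong h'b'\pi_Y\cong h'\pi_Cb$ built from $\theta_h,\pi_d,\theta_h'^{-1},\pi_b^{-1}$. Consequently there are 1-cells $\underline\pi_f$ and $\bar\pi_h$ with chosen defining invertible 2-cells $\underline\pi_f\circ\operatorname{coker}(f)\cong\operatorname{coker}(f')\circ\pi_X$ and $\ker(h')\circ\bar\pi_h\cong\pi_C\circ\ker(h)$. *)

(* Defs.v *)
Set Implicit Arguments.
Unset Strict Implicit.
Unset Printing Implicit Defensive.

(** * Categories and equivalences *)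

(** [seqm α β] composes in diagrammatic order: first [α], then [β]. *)
Record category : Type := Category {
  obj :> Type;
  mor : obj -> obj -> Type;
  idm : forall x, mor x x;
  seqm : forall x y z, mor x y -> mor y z -> mor x z;
  seqm_idl : forall x y (α : mor x y), seqm (idm x) α = α;
  seqm_idr : forall x y (α : mor x y), seqm α (idm y) = α;
  seqm_assoc : forall x y z t (α : mor x y) (β : mor y z) (γ : mor z t),
    seqm (seqm α β) γ = seqm α (seqm β γ)
}.

Arguments idm {c} x.

Notation "f ⇒ g" := (mor f g) (at level 70, no associativity).
Notation "α ;; β" := (seqm α β) (at level 50, left associativity).

Record iso (C : category) (x y : C) : Type := Iso {
  iso_mor :> x ⇒ y;
  iso_inv : y ⇒ x;
  iso_morK : iso_mor ;; iso_inv = idm x;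
  iso_invK : iso_inv ;; iso_mor = idm y
}.

Notation "f ≅ g" := (iso f g) (at level 70, no associativity).

Definition invertible (C : category) (x y : C) (α : x ⇒ y) : Prop :=
  exists β : y ⇒ x, α ;; β = idm x /\ β ;; α = idm y.

Definition isomorphic (C : category) (x y : C) : Prop := inhabited (x ≅ y).

Record functor (C D : category) : Type := Functor {
  fobj :> C -> D;
  fmor : forall x y : C, x ⇒ y -> fobj x ⇒ fobj y;
  fmor_id : forall x : C, fmor (idm x) = idm (fobj x);
  fmor_seq : forall (x y z : C) (α : x ⇒ y) (β : y ⇒ z),
    fmor (α ;; β) = fmor α ;; fmor β
}.

Arguments fmor {C D} f {x y} α.

Definition equivalent_categories (C D : category) : Prop :=
  exists (F : functor C D) (G : functor D C)
         (η : forall x : C, x ≅ G (F x)) (ε : forall y : D, F (G y) ≅ y),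
    (forall (x x' : C) (α : x ⇒ x'), α ;; η x' = η x ;; fmor G (fmor F α)) /\
    (forall (y y' : D) (β : y ⇒ y'), fmor F (fmor G β) ;; ε y' = ε y ;; β).

Definition terminal_category : category.
Proof.
  refine (@Category unit (fun _ _ => unit) (fun _ => tt)
            (fun _ _ _ _ _ => tt) _ _ _).
  - intros x y []; reflexivity.
  - intros x y []; reflexivity.
  - reflexivity.
Defined.

(** * Strict 2-categories *)

(** The identity 2-cell between equal 1-cells.  It is needed because the
    strict laws [h ∘ (g ∘ f) = (h ∘ g) ∘ f], etc., are propositional and not
    definitional equalities, so that 2-cells with equal boundaries may have
    different types. *)
Definition iso_of_eq (C : category) (x y : C) (e : x = y) : x ≅ y :=
  match e in _ = z return x ≅ z with
  | eq_refl => Iso (seqm_idl (idm x)) (seqm_idr (idm x))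
  end.

(** [comp1 g f] and [comp2 β α] are [g ∘ f] and [β * α], in the applicative
    order.  The last three axioms say that horizontal composition of 2-cells
    is strictly associative and unital. *)
Record two_category : Type := TwoCategory {
  ob :> Type;
  hom : ob -> ob -> category;
  id1 : forall A, hom A A;
  comp1 : forall A B C, hom B C -> hom A B -> hom A C;
  comp2 : forall A B C (g g' : hom B C) (f f' : hom A B),
    g ⇒ g' -> f ⇒ f' -> comp1 g f ⇒ comp1 g' f';
  comp2_id : forall A B C (g : hom B C) (f : hom A B),
    comp2 (idm g) (idm f) = idm (comp1 g f);
  interchange : forall A B C (g g' g'' : hom B C) (f f' f'' : hom A B)
    (β : g ⇒ g') (β' : g' ⇒ g'') (α : f ⇒ f') (α' : f' ⇒ f''),
    comp2 (β ;; β') (α ;; α') = comp2 β α ;; comp2 β' α';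
  comp1_assoc : forall A B C D (h : hom C D) (g : hom B C) (f : hom A B),
    comp1 h (comp1 g f) = comp1 (comp1 h g) f;
  comp1_idl : forall A B (f : hom A B), comp1 (id1 B) f = f;
  comp1_idr : forall A B (f : hom A B), comp1 f (id1 A) = f;
  comp2_assoc : forall A B C D (h h' : hom C D) (g g' : hom B C)
    (f f' : hom A B) (γ : h ⇒ h') (β : g ⇒ g') (α : f ⇒ f'),
    comp2 γ (comp2 β α) ;; iso_of_eq (comp1_assoc h' g' f')
    = iso_of_eq (comp1_assoc h g f) ;; comp2 (comp2 γ β) α;
  comp2_idl : forall A B (f f' : hom A B) (α : f ⇒ f'),
    comp2 (idm (id1 B)) α ;; iso_of_eq (comp1_idl f')
    = iso_of_eq (comp1_idl f) ;; α;
  comp2_idr : forall A B (f f' : hom A B) (α : f ⇒ f'),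
    comp2 α (idm (id1 A)) ;; iso_of_eq (comp1_idr f')
    = iso_of_eq (comp1_idr f) ;; α
}.

Arguments hom {t} A B.
Arguments comp1 {t A B C} g f.
Arguments comp2 {t A B C g g' f f'} β α.

Notation "g ∘ f" := (comp1 g f) (at level 40, left associativity).
Notation "g ◁ α" := (comp2 (idm g) α) (at level 40, no associativity).
Notation "β ▷ f" := (comp2 β (idm f)) (at level 40, no associativity).

Definition assoc (L : two_category) (A B C D : L)
    (h : hom C D) (g : hom B C) (f : hom A B) : h ∘ (g ∘ f) ≅ (h ∘ g) ∘ f :=
  iso_of_eq (comp1_assoc h g f).

(** * 2-kernels, 2-cokernels and homological self-duality *)

Section ZExact.

Variables (L : two_category) (O : L).

Definition bizero : Prop :=
  forall A : L,
    equivalent_categories (hom A O) terminal_category /\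
    equivalent_categories (hom O A) terminal_category.

Definition null (A B : L) (f : hom A B) : Prop :=
  exists (v : hom O B) (u : hom A O), f = v ∘ u.

Definition iso_null (A B : L) (f : hom A B) : Prop :=
  exists z : hom A B, null z /\ isomorphic f z.

Definition strong_bizero : Prop :=
  bizero /\
  forall (A B : L) (f g : hom A B), null f -> null g ->
    exists! α : f ⇒ g, True.

(** When [O] is strong, the invertible 2-cell from [f ∘ k] to a given null
    1-cell is unique, so only its existence is recorded. *)
Definition is_2kernel (A B K : L) (f : hom A B) (k : hom K A) : Prop :=
  iso_null (f ∘ k) /\
  (forall (Z : L) (z : hom Z A), iso_null (f ∘ z) ->
    exists u : hom Z K, isomorphic (k ∘ u) z) /\
  (forall (Z : L) (u v : hom Z K) (λ : k ∘ u ⇒ k ∘ v),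
    exists! μ : u ⇒ v, k ◁ μ = λ).

Definition is_2cokernel (A B Q : L) (f : hom A B) (q : hom B Q) : Prop :=
  iso_null (q ∘ f) /\
  (forall (Z : L) (z : hom B Z), iso_null (z ∘ f) ->
    exists u : hom Q Z, isomorphic (u ∘ q) z) /\
  (forall (Z : L) (u v : hom Q Z) (λ : u ∘ q ⇒ v ∘ q),
    exists! μ : u ⇒ v, μ ▷ q = λ).

Record two_kernel (A B : L) (f : hom A B) : Type := TwoKernel {
  Ker : L;
  ker : hom Ker A;
  ker_spec : is_2kernel f ker
}.

Record two_cokernel (A B : L) (f : hom A B) : Type := TwoCokernel {
  Cok : L;
  coker : hom B Cok;
  coker_spec : is_2cokernel f coker
}.

Definition two_z_exact : Prop :=
  strong_bizero /\
  (forall (A B : L) (f : hom A B), inhabited (two_kernel f)) /\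
  (forall (A B : L) (f : hom A B), inhabited (two_cokernel f)).

Definition normal_2mono (K A : L) (m : hom K A) : Prop :=
  exists (B : L) (f : hom A B), is_2kernel f m.

Definition normal_2epi (B Q : L) (e : hom B Q) : Prop :=
  exists (A : L) (f : hom A B), is_2cokernel f e.

Definition normal (A B : L) (f : hom A B) : Prop :=
  exists (I : L) (e : hom A I) (m : hom I B),
    normal_2epi e /\ normal_2mono m /\ isomorphic f (m ∘ e).

Definition homologically_self_dual : Prop :=
  two_z_exact /\
  forall (K X R : L) (m : hom K X) (e : hom X R),
    normal_2mono m -> normal_2epi e -> iso_null (e ∘ m) ->
    forall (Cm : two_cokernel m) (Ke : two_kernel e),
      normal (coker Cm ∘ ker Ke).

Definition short_2exact (A B C : L) (k : hom A B) (q : hom B C) : Prop :=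
  is_2kernel q k /\ is_2cokernel k q.

(** * Pure configurations *)

Record pure_configuration : Type := PureConfiguration {
  pcA : L; pcY : L; pcC : L; pcX : L; pcZ : L;
  pc_a : hom pcA pcY;
  pc_b : hom pcY pcC;
  pc_c : hom pcX pcY;
  pc_d : hom pcY pcZ;
  pc_top : short_2exact pc_a pc_b;
  pc_bottom : short_2exact pc_c pc_d;
  pc_f : hom pcA pcX;
  pc_h : hom pcC pcZ;
  pc_θf : pc_a ≅ pc_c ∘ pc_f;
  pc_θh : pc_h ∘ pc_b ≅ pc_d
}.

Record comparison (P : pure_configuration)
    (Cf : two_cokernel (pc_f P)) (Kh : two_kernel (pc_h P)) : Type :=
  Comparison {
    cmp :> hom (Cok Cf) (Ker Kh);
    cmp_cell : ker Kh ∘ (cmp ∘ coker Cf) ≅ pc_b P ∘ pc_c P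
  }.

Record pc_morphism (P P' : pure_configuration) : Type := PCMorphism {
  morA : hom (pcA P) (pcA P');
  morY : hom (pcY P) (pcY P');
  morC : hom (pcC P) (pcC P');
  morX : hom (pcX P) (pcX P');
  morZ : hom (pcZ P) (pcZ P');
  mor_a : morY ∘ pc_a P ≅ pc_a P' ∘ morA;
  mor_b : morC ∘ pc_b P ≅ pc_b P' ∘ morY;
  mor_c : morY ∘ pc_c P ≅ pc_c P' ∘ morX;
  mor_d : morZ ∘ pc_d P ≅ pc_d P' ∘ morY
}.

Section Induced.

Variables (P P' : pure_configuration) (π : pc_morphism P P').
Variables (Cf : two_cokernel (pc_f P)) (Kh : two_kernel (pc_h P)).
Variables (Cf' : two_cokernel (pc_f P')) (Kh' : two_kernel (pc_h P')).

Record induced_on_cokernels : Type := InducedOnCokernels {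
  ind_cok :> hom (Cok Cf) (Cok Cf');
  ind_cok_cell : ind_cok ∘ coker Cf ≅ coker Cf' ∘ morX π
}.

Record induced_on_kernels : Type := InducedOnKernels {
  ind_ker :> hom (Ker Kh) (Ker Kh');
  ind_ker_cell : ker Kh' ∘ ind_ker ≅ morC π ∘ ker Kh
}.

Variables (j : comparison Cf Kh) (j' : comparison Cf' Kh').
Variables (πf : induced_on_cokernels) (πh : induced_on_kernels).

Definition cell_α :
    ker Kh' ∘ ((j' ∘ πf) ∘ coker Cf) ⇒ morC π ∘ (pc_b P ∘ pc_c P) :=
     ker Kh' ◁ iso_inv (assoc j' πf (coker Cf))
  ;; ker Kh' ◁ (j' ◁ ind_cok_cell πf)
  ;; ker Kh' ◁ assoc j' (coker Cf') (morX π)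
  ;; assoc (ker Kh') (j' ∘ coker Cf') (morX π)
  ;; cmp_cell j' ▷ morX π
  ;; iso_inv (assoc (pc_b P') (pc_c P') (morX π))
  ;; pc_b P' ◁ iso_inv (mor_c π)
  ;; assoc (pc_b P') (morY π) (pc_c P)
  ;; iso_inv (mor_b π) ▷ pc_c P
  ;; iso_inv (assoc (morC π) (pc_b P) (pc_c P)).

Definition cell_β :
    ker Kh' ∘ ((πh ∘ j) ∘ coker Cf) ⇒ morC π ∘ (pc_b P ∘ pc_c P) :=
     ker Kh' ◁ iso_inv (assoc πh j (coker Cf))
  ;; assoc (ker Kh') πh (j ∘ coker Cf)
  ;; ind_ker_cell πh ▷ (j ∘ coker Cf)
  ;; iso_inv (assoc (morC π) (ker Kh) (j ∘ coker Cf))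
  ;; morC π ◁ cmp_cell j.

Definition compatible (ν : j' ∘ πf ⇒ πh ∘ j) : Prop :=
  ker Kh' ◁ (ν ▷ coker Cf) ;; cell_β = cell_α.

End Induced.

End ZExact.

Arguments compatible {L O P P' π Cf Kh Cf' Kh'} j j' πf πh ν.

(* Main.v *)
Require Import Defs.

(** Whiskering on the left with a 2-kernel and on the right with a 2-cokernel
    are fully faithful operations on 2-cells.  Hence
    [ν ↦ ker(h') ⋆ ν ⋆ coker(f)] is a bijection from the 2-cells
    [j' ∘ πf ⇒ πh ∘ j] onto the 2-cells between the whiskered 1-cells
    ([whiskered_fully_faithful]), and, like every fully faithful functor, it
    reflects invertibility ([whiskered_reflects_invertible]).

    Both [α] and [β] are pasted from invertible 2-cells, so they are
    invertible.  The compatibility condition therefore says exactly that the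
    image of [ν] is [α] followed by the inverse of [β]: there is one and only
    one such [ν], and it is invertible because its image is. *)

Section InvertibleMorphisms.

Variable C : category.

Lemma iso_invertible (x y : C) (α : x ≅ y) : invertible (iso_mor α).
Proof.
exists (iso_inv α); split; [apply iso_morK | apply iso_invK].
Qed.

Lemma iso_inv_invertible (x y : C) (α : x ≅ y) : invertible (iso_inv α).
Proof.
exists (iso_mor α); split; [apply iso_invK | apply iso_morK].
Qed.

Lemma idm_invertible (x : C) : invertible (idm x).
Proof.
exists (idm x); split; apply seqm_idl.
Qed.

Lemma seqm_invertible (x y z : C) (α : x ⇒ y) (β : y ⇒ z) :
  invertible α -> invertible β -> invertible (α ;; β).
Proof.
intros [α' [αK α'K]] [β' [βK β'K]]; exists (β' ;; α'); split.
- rewrite seqm_assoc, <- (seqm_assoc β), βK, seqm_idl; exact αK.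
- rewrite seqm_assoc, <- (seqm_assoc α'), α'K, seqm_idl; exact β'K.
Qed.

End InvertibleMorphisms.

Lemma comp2_invertible (L : two_category) (A B C : L)
  (g g' : hom B C) (f f' : hom A B) (β : g ⇒ g') (α : f ⇒ f') :
  invertible β -> invertible α -> invertible (comp2 β α).
Proof.
intros [β' [βK β'K]] [α' [αK α'K]]; exists (comp2 β' α'); split.
- rewrite <- interchange, βK, αK; apply comp2_id.
- rewrite <- interchange, β'K, α'K; apply comp2_id.
Qed.

Create HintDb invertible.
#[local] Hint Resolve iso_invertible iso_inv_invertible idm_invertible
  seqm_invertible comp2_invertible : invertible.

Section Whiskering.

Context {L : two_category} {O : L}.

(** [k ◁ (ν ▷ q)] is functorial in [ν]. *)
Lemma whiskered_seqm (A B C D : L) (k : hom C D) (q : hom A B)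
  (u v w : hom B C) (μ : u ⇒ v) (ν : v ⇒ w) :
  k ◁ ((μ ;; ν) ▷ q) = k ◁ (μ ▷ q) ;; k ◁ (ν ▷ q).
Proof.
rewrite <- interchange, seqm_idl, <- interchange, seqm_idl; reflexivity.
Qed.

Lemma whiskered_idm (A B C D : L) (k : hom C D) (q : hom A B)
  (u : hom B C) :
  k ◁ (idm u ▷ q) = idm (k ∘ (u ∘ q)).
Proof.
rewrite comp2_id; apply comp2_id.
Qed.

Context {A B C D E F : L}.
Context {h : hom D E} {k : hom C D} {f : hom F A} {q : hom A B}.
Hypotheses (hk : is_2kernel O h k) (hq : is_2cokernel O f q).

Lemma whiskered_fully_faithful {u v : hom B C}
  (λ : k ∘ (u ∘ q) ⇒ k ∘ (v ∘ q)) :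
  exists! ν : u ⇒ v, k ◁ (ν ▷ q) = λ.
Proof.
destruct hk as [_ [_ ffk]], hq as [_ [_ ffq]].
destruct (ffk _ _ _ λ) as [μ [hμ μ_uniq]].
destruct (ffq _ _ _ μ) as [ν [hν ν_uniq]].
exists ν; split.
- rewrite hν; exact hμ.
- intros ν' hν'; apply ν_uniq; symmetry; apply μ_uniq; exact hν'.
Qed.

Lemma whiskered_faithful (u v : hom B C) (μ ν : u ⇒ v) :
  k ◁ (μ ▷ q) = k ◁ (ν ▷ q) -> μ = ν.
Proof.
intros e; destruct (whiskered_fully_faithful (k ◁ (ν ▷ q))) as [ξ [_ uniq]].
rewrite <- (uniq μ e); apply uniq; reflexivity.
Qed.

Lemma whiskered_reflects_invertible (u v : hom B C) (ν : u ⇒ v) :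
  invertible (k ◁ (ν ▷ q)) -> invertible ν.
Proof.
intros [λ [νK λK]].
destruct (whiskered_fully_faithful λ) as [μ [hμ _]].
exists μ; split; apply whiskered_faithful;
  rewrite whiskered_seqm, hμ, whiskered_idm; assumption.
Qed.

End Whiskering.

Section PastedCells.

Context {L : two_category} {O : L}.
Context {P P' : pure_configuration O} {π : pc_morphism P P'}.
Context {Cf : two_cokernel O (pc_f P)} {Kh : two_kernel O (pc_h P)}.
Context {Cf' : two_cokernel O (pc_f P')} {Kh' : two_kernel O (pc_h P')}.
Variables (j : comparison Cf Kh) (j' : comparison Cf' Kh').

Lemma cell_α_invertible (πf : induced_on_cokernels π Cf Cf') :
  invertible (cell_α j' πf).
Proof.
unfold cell_α; auto 20 with invertible.
Qed.

Lemma cell_β_invertible (πh : induced_on_kernels π Kh Kh') :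
  invertible (cell_β j πh).
Proof.
unfold cell_β; auto 20 with invertible.
Qed.

End PastedCells.

Theorem theorem7p6
  (L : two_category) (O : L) (hL : homologically_self_dual O)
  (P P' : pure_configuration O) (π : pc_morphism P P')
  (Cf : two_cokernel O (pc_f P)) (Kh : two_kernel O (pc_h P))
  (Cf' : two_cokernel O (pc_f P')) (Kh' : two_kernel O (pc_h P'))
  (j : comparison Cf Kh) (j' : comparison Cf' Kh')
  (πf : induced_on_cokernels π Cf Cf') (πh : induced_on_kernels π Kh Kh') :
  exists! ν : j' ∘ πf ⇒ πh ∘ j,
    invertible ν /\ compatible j j' πf πh ν.
Proof.
destruct (cell_β_invertible j πh) as [β' [βK β'K]].
assert (β'_invertible : invertible β') by (exists (cell_β j πh); auto).
destruct (whiskered_fully_faithful (ker_spec Kh') (coker_spec Cf)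
            (cell_α j' πf ;; β')) as [ν [hν ν_uniq]].
exists ν; split; [split |].
- apply (whiskered_reflects_invertible (ker_spec Kh') (coker_spec Cf)).
  rewrite hν; apply seqm_invertible;
    [apply cell_α_invertible | exact β'_invertible].
- unfold compatible; rewrite hν, seqm_assoc, β'K; apply seqm_idr.
- intros ν' [_ hν']; apply ν_uniq.
  rewrite <- hν', seqm_assoc, βK, seqm_idr; reflexivity.
Qed.
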